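(* Let $G$ be an MP-digraph. Then the multipath matroid $M_G$ is binary, i.e. representable over the field $\mathbb F_2$.
   Context: Digraphs: finite, at most one edge $(v,w)$ from $v$ to $w$ for distinct $v,w$, loops allowed. A multipath of $G$ is a spanning subgraph each connected component of which is a vertex or a simple path (a sequence of non-loop edges $e_1,\dots,e_n$ with target of $e_i$ = source of $e_{i+1}$, no repeated vertices, not closing into a cycle); $\mathrm{Mult}(G)$ is the set of multipaths identified with their edge sets, and $M_G=(E(G),\mathrm{Mult}(G))$. An MP-digraph is a digraph $G$ such that (MP1) $G$ has no subgraph isomorphic to $D_A$ (vertices $v_0,v_1,v_2$, edges $(v_1,v_0),(v_0,v_2),(v_1,v_2)$) or $D_B$ (vertices $v_0,\dots,v_3$, edges $(v_0,v_1),(v_2,v_1),(v_2,v_3)$) or their edge-reversals, and (MP2) every coherently oriented cycle of length $\ge 2$ is a connected component; then $M_G$ is a matroid. A matroid on $X$ is representable over a field $\mathbb F$ if there is a matrix over $\mathbb F$ and a bijection from $X$ to its columns under which independent sets correspond to linearly independent sets of columns. *)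

(* Defs.v *)
From HB Require Import structures.
From mathcomp Require Import all_boot all_order all_algebra.

Set Implicit Arguments.
Unset Strict Implicit.
Unset Printing Implicit Defensive.

(* Loops (v, v) are allowed; antiparallel arcs (v, w), (w, v) are allowed. *)
Record digraph := Digraph { vert : finType; arcs : {set vert * vert} }.

Definition arc (G : digraph) : rel (vert G) :=
  [rel x y | (x, y) \in arcs G].

Definition reversal (H : digraph) : digraph :=
  Digraph [set (e.2, e.1) | e in arcs H].

(* The image of f is a (not necessarily induced) subgraph of G isomorphic
   to H. *)
Definition has_subgraph_isomorphic_to (G H : digraph) : Prop :=
  exists f : vert H -> vert G,
    injective f /\ forall x y, arc x y -> arc (f x) (f y).

Definition D_A : digraph :=
  Digraph [set e : 'I_3 * 'I_3 |
    (val e.1, val e.2) \in [:: (1, 0); (0, 2); (1, 2)]].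

Definition D_B : digraph :=
  Digraph [set e : 'I_4 * 'I_4 |
    (val e.1, val e.2) \in [:: (0, 1); (2, 1); (2, 3)]].

Definition adjacent (G : digraph) : rel (vert G) :=
  [rel x y | arc x y || arc y x].

(* The subgraph with vertex set W and arc set F is a connected component of
   the graph underlying G; F contains the loops at the vertices of W. *)
Definition is_component (G : digraph)
    (W : {set vert G}) (F : {set vert G * vert G}) : Prop :=
  (exists v, W = [set w | connect (@adjacent G) v w]) /\
  F = [set e in arcs G | (e.1 \in W) && (e.2 \in W)].

(* The vertices met along the sequence of arcs e :: s. *)
Definition path_vertices (V : finType) (e : V * V) (s : seq (V * V)) : seq V :=
  e.1 :: [seq a.2 | a <- e :: s].

(* Distinctness of the vertices includes that the last target is not the first
   source, i.e. that the path does not close up. *)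
Definition simple_path (V : finType) (e : V * V) (s : seq (V * V)) : bool :=
  [&& all [pred a | a.1 != a.2] (e :: s),
      path [rel a b | a.2 == b.1] e s
    & uniq (path_vertices e s)].

(* A spanning subgraph is given by its arc set A. *)
Definition multipath (G : digraph) (A : {set vert G * vert G}) : Prop :=
  A \subset arcs G /\
  forall W F, @is_component (Digraph A) W F ->
    (exists v, W = [set v] /\ F = set0) \/
    (exists e s, [/\ simple_path e s,
       W = [set v in path_vertices e s] & F = [set a in e :: s]]).

Definition MP1 (G : digraph) : Prop :=
  [/\ ~ has_subgraph_isomorphic_to G D_A,
      ~ has_subgraph_isomorphic_to G D_B,
      ~ has_subgraph_isomorphic_to G (reversal D_A)
    & ~ has_subgraph_isomorphic_to G (reversal D_B)].

(* A coherently oriented cycle is given by the sequence c of its vertices. *)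
Definition MP2 (G : digraph) : Prop :=
  forall c : seq (vert G), 2 <= size c -> uniq c -> cycle (@arc G) c ->
    is_component [set x in c] [set (x, next c x) | x in c].

Definition MP_digraph (G : digraph) : Prop := MP1 G /\ MP2 G.

(* Matroids on a ground set X, given by their independent sets. *)
Definition is_matroid (T : finType) (X : {set T}) (indep : {set T} -> Prop) :
    Prop :=
  [/\ forall S, indep S -> S \subset X,
      indep set0,
      forall S S' : {set T}, S' \subset S -> indep S -> indep S'
    & forall S S' : {set T}, indep S -> indep S' -> #|S| < #|S'| ->
        exists x, [/\ x \in S', x \notin S & indep (x |: S)]].

(* Linear independence is that of the family of columns, so that two equal
   columns are dependent. *)
Definition representable (F : fieldType) (T : finType) (X : {set T})
    (indep : {set T} -> Prop) : Prop :=
  is_matroid X indep /\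
  exists (m n : nat) (A : 'M[F]_(m, n)) (phi : {x : T | x \in X} -> 'I_n),
    bijective phi /\
    forall S : {set {x : T | x \in X}},
      indep (val @: S) <-> free [seq col (phi x) A | x <- enum S].

Definition binary (T : finType) (X : {set T}) (indep : {set T} -> Prop) : Prop :=
  representable 'F_2 X indep.

(* Main.v *)
(** Discard the loops of an MP-digraph; they are loops of the matroid and get
    the zero column. A set of arcs is a multipath iff no two of its arcs share a
    source, no two share a target, and it contains no directed cycle. MP1 says
    that no arc shares its source with one arc and its target with another, so
    "equal or sharing an endpoint in the same role" is an equivalence relation
    on arcs; MP2 says that an arc on a directed cycle is alone in its class.
    Hence the matroid is a direct sum of rank-one uniform matroids, one for each
    class off the cycles, and of the circuits given by the directed cycles. Over
    F_2, give all arcs of a class the same basis vector, and an arc (x, y) on a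
    directed cycle the column e_x + e_y. *)

Require Import Defs.
From HB Require Import structures.
From mathcomp Require Import all_boot all_order all_algebra.

Set Implicit Arguments.
Unset Strict Implicit.
Import GRing.Theory.

(** * Multipaths as sets of arcs without conflicts or directed cycles *)

Definition linear_forest (V : finType) (A : {set V * V}) : Prop :=
  [/\ {in A &, injective fst}, {in A &, injective snd}
    & forall c : seq V,
        c != [::] -> uniq c -> ~ cycle (@Defs.arc (Digraph A)) c].

Lemma adjacent_connect_sym (V : finType) (A : {set V * V}) :
  connect_sym (@adjacent (Digraph A)).
Proof. by apply: sym_connect_sym => x y; rewrite /adjacent /= orbC. Qed.

Lemma index_simple_path (V : finType) (e a : V * V) s :
  simple_path e s -> a \in e :: s ->
  [/\ a.1 \in path_vertices e s, a.2 \in path_vertices e s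
    & index a.2 (path_vertices e s) = (index a.1 (path_vertices e s)).+1].
Proof.
elim: s e => [|e' s IHs] e.
  case/and3P=> /andP[/= ne _] _ _; rewrite inE => /eqP->.
  by rewrite /path_vertices /= !inE !eqxx orbT (negPf ne).
case/and3P => /andP[ne Hall] /andP[/eqP ee' Hp] Huniq.
have pvE : path_vertices e (e' :: s) = e.1 :: path_vertices e' s.
  by rewrite /path_vertices /= -ee'.
move: Huniq; rewrite pvE cons_uniq => /andP[nin Huniq].
have sp' : simple_path e' s by apply/and3P.
rewrite inE => /predU1P[->|/(IHs _ sp') [a1 a2 Ha]].
  rewrite {2 4}/path_vertices -ee' /= !inE !eqxx orbT.
  by rewrite /path_vertices -ee' /= !eqxx (negPf ne).
move: (path_vertices e' s) nin a1 a2 Ha => q nin a1 a2 Ha.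
have E b : b \in q -> (e.1 == b) = false.
  by move=> Hb; apply: contraNF nin => /eqP->.
by rewrite inE a1 orbT inE a2 orbT /= (E _ a1) (E _ a2) Ha.
Qed.

(** The rank is the position along the path that forms the component; a one-vertex component
    contains no arc, so a constant rank does there. *)
Lemma multipath_component_rank (G : digraph) (A : {set vert G * vert G}) v :
  multipath A -> exists r : vert G -> nat,
    {in [set w | connect (@adjacent (Digraph A)) v w] &, injective r} /\
    forall a, a \in A -> connect (@adjacent (Digraph A)) v a.1 ->
      r a.2 = (r a.1).+1.
Proof.
case=> _ compA; set W := [set w | _].
pose F := [set a in A | (a.1 \in W) && (a.2 \in W)].
have inF a : a \in A -> connect (@adjacent (Digraph A)) v a.1 -> a \in F.
  move=> aA va1; rewrite !inE aA va1 /=; apply: connect_trans va1 (connect1 _).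
  by rewrite /adjacent /= /Defs.arc /= -surjective_pairing aA.
have [|[w [WE FE]]|[e [s [sp WE FE]]]] := compA W F.
- by split=> //; exists v.
- exists (fun=> 0); split=> [x y|a aA va1].
    by rewrite WE !inE => /eqP-> /eqP->.
  by have := inF a aA va1; rewrite FE inE.
exists (index^~ (path_vertices e s)); split=> [x y|a aA va1].
  by rewrite WE !inE => xW yW; apply: index_inj.
by have := inF a aA va1; rewrite FE inE => /(index_simple_path sp) [].
Qed.


(** Arcs with a common source have targets of equal rank, arcs with a common target have sources of
    equal rank, and ranks are injective on a component. On a directed cycle, a vertex of maximal
    rank would have a successor of larger rank. *)
Lemma multipath_linear_forest (G : digraph) (A : {set vert G * vert G}) :
  multipath A -> linear_forest A.
Proof.
move=> mA; have adj a : a \in A -> @adjacent (Digraph A) a.1 a.2.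
  by move=> aA; rewrite /adjacent /= /Defs.arc /= -surjective_pairing aA.
split=> [a b aA bA ab|a b aA bA ab|[//|x p] _ _ cyc_c].
- have [r [r_inj r_succ]] := multipath_component_rank a.1 mA.
  have b2 := connect1 (adj b bA); rewrite -ab in b2.
  apply: injective_projections => //.
  apply: r_inj; rewrite ?inE //; first exact: connect1 (adj a aA).
  by rewrite !r_succ -?ab ?connect0.
- have [r [r_inj r_succ]] := multipath_component_rank a.2 mA.
  have a1 : connect (@adjacent (Digraph A)) a.2 a.1.
    by rewrite adjacent_connect_sym connect1 ?adj.
  have b1 : connect (@adjacent (Digraph A)) a.2 b.1.
    by rewrite ab adjacent_connect_sym connect1 ?adj.
  apply: injective_projections => //.
  apply: r_inj; rewrite ?inE //.
  by have := r_succ b bA b1; rewrite -ab r_succ // => -[].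
have [r [_ r_succ]] := multipath_component_rank x mA.
have xc : x \in x :: p by rewrite mem_head.
case: (@arg_maxnP _ x (mem (x :: p)) r xc) => y yc r_max.
have yA := next_cycle cyc_c yc.
have nyc : next (x :: p) y \in x :: p by rewrite mem_next.
have := r_max _ nyc; apply/negP.
rewrite -ltnNge (r_succ (y, next (x :: p) y)) //.
apply: connect_sub (connect_cycle cyc_c xc yc) => u v uv; apply: connect1.
by rewrite /adjacent /= uv.
Qed.

(** Cut at [u], the path leaves an initial segment that the arc from [u] to [x] closes up. *)
Lemma path_back_arc_cycle (V : finType) (r : rel V) x p u :
  path r x p -> uniq (x :: p) -> u \in x :: p -> r u x ->
  exists c, [/\ c != [::], uniq c & cycle r c].
Proof.
move=> rp up /splitPl up'; case: up' rp up => p1 p2 <-.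
rewrite cat_path => /andP[rp1 _]; rewrite -cat_cons cat_uniq => /and3P[up1 _ _].
by move=> rux; exists (x :: p1); rewrite /= rcons_path rp1.
Qed.

Lemma map_fst_pairmap (V : Type) (x : V) p :
  [seq a.1 | a <- pairmap pair x p] = belast x p.
Proof. by elim: p x => //= y p IHp x; rewrite IHp. Qed.

Lemma map_snd_pairmap (V : Type) (x : V) p :
  [seq a.2 | a <- pairmap pair x p] = p.
Proof. by elim: p x => //= y p IHp x; rewrite IHp. Qed.

Lemma path_pairmap (V : Type) (r : rel V) x p :
  path r x p = all [pred a | r a.1 a.2] (pairmap pair x p).
Proof. by elim: p x => //= y p IHp x; rewrite IHp. Qed.

Lemma pairmap_simple_path (V : finType) (x y : V) p : uniq [:: x, y & p] ->
  simple_path (x, y) (pairmap pair y p).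
Proof.
move=> u; apply/and3P; split; last first.
- by rewrite /path_vertices /= map_snd_pairmap.
- by elim: p x y {u} => //= z p IHp x y; rewrite eqxx IHp.
elim: p x y u => [|z p IHp] x y; first by rewrite /= !inE !andbT.
case/andP; rewrite inE negb_or => /andP[xy _] u.
by apply/andP; split=> //; apply: IHp.
Qed.

(** Take a longest path through [v]. An arc leaving a vertex other than the last shares its source
    with an arc of the path, hence is that arc; an arc from the last vertex to a vertex off the path
    would extend it. Entering arcs are treated symmetrically. *)
Lemma linear_forest_maximal_path (V : finType) (A : {set V * V}) v :
  linear_forest A ->
  exists x p, [/\ path (@Defs.arc (Digraph A)) x p, uniq (x :: p),
    v \in x :: p & forall y z, @adjacent (Digraph A) y z ->
      y \in x :: p -> z \in x :: p].
Proof.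
move=> [inj1 inj2 acyc]; set r := @Defs.arc (Digraph A).
(* Tuples make the existence of a path on [n] vertices a boolean predicate, as [ex_maxnP]
   requires. *)
pose P n := [exists t : n.-tuple V, [&& sorted r t, uniq t & v \in t]].
have PP s : sorted r s -> uniq s -> v \in s -> P (size s).
  by move=> rs us vs; apply/existsP; exists (in_tuple s); rewrite rs us.
have exP : exists n, P n by exists 1; apply: (PP [:: v]); rewrite ?inE.
have ubP n : P n -> n <= #|V|.
  case/existsP=> t /and3P[_ /card_uniqP ut _].
  by rewrite -(size_tuple t) -ut max_card.
case: (ex_maxnP exP ubP) => n /existsP[[[|x p] sz] /and3P[//= rp up vp]] n_max.
rewrite memtE /= in vp.
have maxP s :
    sorted r s -> uniq s -> v \in s -> size s <= (size p).+1.
  by move=> *; rewrite -[(size p).+1]/(size (x :: p)) (eqP sz) n_max ?PP.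
have arcA := rp; rewrite path_pairmap in arcA.
exists x, p; split=> // y z /orP[] ryz yp.
- move: yp; rewrite {1}lastI mem_rcons inE => /predU1P[yE|].
    have [//|zp] := boolP (z \in x :: p); have := maxP (rcons (x :: p) z).
    rewrite size_rcons rcons_uniq zp mem_rcons inE vp orbT /=.
    by rewrite rcons_path rp -yE [r _ _]ryz up ltnn => /(_ isT isT isT).
  rewrite -map_fst_pairmap => /mapP[b bp yE].
  have /= bA := allP arcA b bp.
  have -> : z = b.2.
    by rewrite -(inj1 (y, z) b) //= [b]surjective_pairing.
  by rewrite inE -{1}(map_snd_pairmap x p) map_f ?orbT.
- move: yp; rewrite inE => /predU1P[yE|].
    have [//|zp] := boolP (z \in x :: p); have := maxP (z :: x :: p).
    rewrite cons_uniq zp inE vp orbT /= up rp -yE [r _ _]ryz ltnn.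
    by move=> /(_ isT isT isT).
  rewrite -{1}(map_snd_pairmap x p) => /mapP[b bp yE].
  have /= bA := allP arcA b bp.
  have -> : z = b.1.
    by rewrite -(inj2 (z, y) b) //= [b]surjective_pairing.
  by rewrite lastI mem_rcons inE -map_fst_pairmap map_f ?orbT.
Qed.

Lemma linear_forest_multipath (G : digraph) (A : {set vert G * vert G}) :
  A \subset arcs G -> linear_forest A -> multipath A.
Proof.
move=> sAG lfA; split=> // _ _ [[v ->] ->].
have [x [p [rp up vp p_closed]]] := linear_forest_maximal_path v lfA.
have [_ inj2 acyc] := lfA; set W := [set w | _].
have WE : W = [set w in x :: p].
  apply/setP=> w; rewrite [LHS]in_set [RHS]in_set; apply/idP/idP => [vw|wp].
    have cl : closed (@adjacent (Digraph A)) (mem (x :: p)).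
      apply: intro_closed; first exact: adjacent_connect_sym.
      by move=> y z; apply: p_closed.
    by rewrite -(closed_connect cl vw).
  have conn u : u \in x :: p -> connect (@adjacent (Digraph A)) x u.
    move=> /(path_connect rp).
    apply: connect_sub => y z yz; apply: connect1.
    by rewrite /adjacent /= yz.
  apply: connect_trans (conn w wp); rewrite adjacent_connect_sym; exact: conn.
have FE : [set e in A | (e.1 \in W) && (e.2 \in W)] =
    [set a in pairmap pair x p].
  apply/setP=> a; rewrite WE !inE -!in_cons; apply/and3P/idP => [[aA a1 a2]|ap].
    (* An arc of the component that ends at the start of the path would close a cycle; any other
       shares its target with an arc of the path. *)
    move: a2; rewrite inE => /predU1P[a2|].
      have [|c [c0 uc cc]] := path_back_arc_cycle rp up a1.
        by rewrite -a2 /Defs.arc /= -surjective_pairing.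
      by case: (acyc c c0 uc cc).
    rewrite -{1}(map_snd_pairmap x p) => /mapP[b bp ab].
    rewrite (inj2 a b) //; move: rp; rewrite path_pairmap => /allP /(_ b bp).
    by rewrite /= /Defs.arc /= -surjective_pairing.
  split; first move: rp.
  - rewrite path_pairmap => /allP /(_ a ap).
    by rewrite /= /Defs.arc /= -surjective_pairing.
  - by rewrite lastI mem_rcons inE -map_fst_pairmap map_f ?orbT.
  - by rewrite inE -{1}(map_snd_pairmap x p) map_f ?orbT.
rewrite /= FE WE; case: p up {rp vp p_closed WE FE} => [|y p] up.
  by left; exists x; split; apply/setP=> a; rewrite !inE.
right; exists (x, y), (pairmap pair y p); split=> //.
  exact: pairmap_simple_path.
by rewrite /path_vertices /= map_snd_pairmap.
Qed.

(** * Conflicts and cycles under MP1 and MP2 *)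

Lemma MP1_zigzag (G : digraph) (a b c d : vert G) : MP1 G ->
  Defs.arc a b -> Defs.arc c b -> Defs.arc c d ->
  a != b -> c != b -> c != d -> a != c -> b = d.
Proof.
case=> noA noB _ _ ab cb cd nab ncb ncd nac; apply/eqP/negPn/negP => nbd.
have nth_inj (s : seq (vert G)) n : uniq s -> size s = n ->
    injective (fun i : 'I_n => nth a s i).
  move=> us <- i j /eqP; rewrite nth_uniq // => /eqP; exact: val_inj.
(* If [b] and [d] differ, the three arcs form [D_A] when [a = d], and [D_B] otherwise. *)
have [ad|nad] := eqVneq a d.
  apply: noA; exists (fun i : 'I_3 => nth a [:: a; c; b] i); split.
    by apply: nth_inj; rewrite //= !inE negb_or nac nab ncb.
  move=> x y; rewrite {1}/Defs.arc /= !inE /= !xpair_eqE.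
  by case/or3P=> /andP[/eqP-> /eqP->] //=; rewrite ad.
apply: noB; exists (fun i : 'I_4 => nth a [:: a; b; c; d] i); split.
  apply: nth_inj; rewrite //= !inE !negb_or nab nac nad nbd ncd.
  by rewrite eq_sym ncb.
move=> x y; rewrite {1}/Defs.arc /= !inE /= !xpair_eqE.
by case/or3P=> /andP[/eqP-> /eqP->].
Qed.

(** Adjacent vertices lie in the same component, so by MP2 an arc with one end on [c] has both ends
    there, and the component has no arcs besides those of the cycle. *)
Lemma MP2_cycle_arc (G : digraph) (c : seq (vert G)) (f : vert G * vert G) :
  MP2 G -> 1 < size c -> uniq c -> cycle (@Defs.arc G) c -> f \in arcs G ->
  (f.1 \in c) || (f.2 \in c) -> f.1 \in c /\ f.2 = next c f.1.
Proof.
move=> mp2 c2 uc cc fG fc; have [[v Wv] Fc] := mp2 c c2 uc cc.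
have adj_f : @adjacent G f.1 f.2.
  by rewrite /adjacent /= /Defs.arc /= -surjective_pairing fG.
have csym : connect_sym (@adjacent G).
  by apply: sym_connect_sym => x y; rewrite /adjacent /= orbC.
have cE x : (x \in c) = connect (@adjacent G) v x.
  by move/setP/(_ x): Wv; rewrite !inE.
have f12 : (f.1 \in c) = (f.2 \in c).
  by rewrite !cE; apply: (same_connect_r csym (connect1 adj_f)).
move: fc; rewrite -f12 orbb => f1c; split=> //.
move/setP/(_ f): Fc; rewrite !inE fG -f12 f1c => /imsetP[x _ ->] //.
Qed.

Definition loopless (V : eqType) (e : V * V) := e.1 != e.2.

(** Reachability gives a boolean test: for a loopless arc of [G], shortening the walk back and
    closing it with the arc yields a cycle of length at least two. Loops pass the test trivially,
    hence the separate [loopless] conditions. *)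
Definition on_cycle (G : digraph) (e : vert G * vert G) :=
  connect (@Defs.arc G) e.2 e.1.

Lemma on_cycleP (G : digraph) (e : vert G * vert G) :
  e \in arcs G -> loopless e -> on_cycle e ->
  exists c, [/\ 1 < size c, uniq c, cycle (@Defs.arc G) c & e.1 \in c].
Proof.
move=> eG ne /connectP[p0 ep0 e1].
case: (shortenP ep0) e1 => p ep up _ e1.
exists (e.2 :: p); split=> //.
- by case: p e1 {ep up} => //= e1; rewrite /loopless e1 eqxx in ne.
- by rewrite /= rcons_path ep -e1 /Defs.arc /= -surjective_pairing.
- by rewrite e1 mem_last.
Qed.

Lemma cycle_on_cycle (G : digraph) (c : seq (vert G)) x :
  cycle (@Defs.arc G) c -> x \in c -> on_cycle (x, next c x).
Proof.
by move=> cc xc; apply: (connect_cycle cc) => //=; rewrite mem_next.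
Qed.

Lemma on_cycle_incident (G : digraph) (e f : vert G * vert G) :
  MP2 G -> e \in arcs G -> f \in arcs G -> loopless e -> on_cycle e ->
  (f.1 == e.1) || (f.1 == e.2) || (f.2 == e.1) || (f.2 == e.2) ->
  on_cycle f.
Proof.
move=> mp2 eG fG ne /(on_cycleP eG ne)[c [c2 uc cc ec]] ef.
have [_ e2] := MP2_cycle_arc mp2 c2 uc cc eG (introT orP (or_introl ec)).
have [f1c f2] : f.1 \in c /\ f.2 = next c f.1.
  apply: MP2_cycle_arc => //; move: ef; rewrite e2.
  by case/orP=> [/orP[/orP[]|]|] /eqP->; rewrite ?mem_next ec ?orbT.
by rewrite [f]surjective_pairing f2; apply: cycle_on_cycle.
Qed.

(* By MP1 an arc cannot share both its source and its target with other arcs,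
   so that the arcs of an MP-digraph that conflict with [e] (or are [e]) are
   those with the key of [e]. *)
Definition arc_key (G : digraph) (e : vert G * vert G) : vert G + vert G :=
  if [exists f in arcs G, [&& loopless f, f != e & f.2 == e.2]]
  then inr e.2 else inl e.1.

Lemma arc_key_eq (G : digraph) (e f : vert G * vert G) :
  arc_key e = arc_key f -> e.1 = f.1 \/ e.2 = f.2.
Proof.
by rewrite /arc_key; case: ifP; case: ifP => _ _ // [->]; [right | left].
Qed.

(** Let [g] and [h] be distinct with a common source. A third arc [k] into the target of [g] would
    give a zigzag [k], [g], [h], and [MP1_zigzag] would force [g = h]. So both keys fall into the
    [inl] case. *)
Lemma arc_key_source (G : digraph) (e f : vert G * vert G) : MP1 G ->
  e \in arcs G -> f \in arcs G -> loopless e -> loopless f ->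
  e.1 = f.1 -> arc_key e = arc_key f.
Proof.
move=> mp1 eG fG ne nf ef; have [->//|nef] := eqVneq e f.
have key g h : g \in arcs G -> h \in arcs G -> loopless g -> loopless h ->
    g.1 = h.1 -> g != h -> arc_key g = inl g.1.
  move=> {e f eG fG ne nf ef nef} gG hG ng nh gh ngh; rewrite /arc_key.
  case: ifP => // /exists_inP[k kG /and3P[nk nkg /eqP kg]].
  case/eqP: ngh; apply: injective_projections => //.
  apply: (@MP1_zigzag G k.1 g.2 g.1 h.2) => //.
  - by rewrite -kg /Defs.arc /= -surjective_pairing.
  - by rewrite /Defs.arc /= -surjective_pairing.
  - by rewrite gh /Defs.arc /= -surjective_pairing.
  - by rewrite -kg.
  - by rewrite gh.
  - by apply: contraNneq nkg => k1; apply/eqP/injective_projections.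
by rewrite (key e f) // (key f e) ?ef // eq_sym.
Qed.

Lemma arc_key_target (G : digraph) (e f : vert G * vert G) :
  e \in arcs G -> f \in arcs G -> loopless e -> loopless f ->
  e.2 = f.2 -> arc_key e = arc_key f.
Proof.
move=> eG fG ne nf ef; have [->//|nef] := eqVneq e f.
rewrite /arc_key ef !ifT //; apply/exists_inP.
  by exists e => //; rewrite ne nef ef eqxx.
by exists f => //; rewrite nf eq_sym nef eqxx.
Qed.

(** * Representation by columns, and linear independence over F_2 *)

Lemma free_map_perm (K : fieldType) (vT : vectType K) (T : eqType)
    (g : T -> vT) (s t : seq T) :
  perm_eq s t -> free [seq g x | x <- s] = free [seq g x | x <- t].
Proof. by move=> st; apply: perm_free; apply: perm_map. Qed.

Lemma free_map_subset (K : fieldType) (vT : vectType K) (T : finType)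
    (g : T -> vT) (S S' : {set T}) : S' \subset S ->
  free [seq g x | x <- enum S] -> free [seq g x | x <- enum S'].
Proof.
move=> sS; rewrite (@free_map_perm _ _ _ _ _ (enum S' ++ enum (S :\: S'))).
  by rewrite map_cat => /catl_free.
apply: uniq_perm; rewrite ?enum_uniq // ?cat_uniq ?enum_uniq ?andbT /=.
  by apply/hasPn=> x; rewrite !mem_enum inE => /andP[].
move=> x; rewrite mem_cat !mem_enum inE.
by case: (boolP (x \in S')) => //= /(subsetP sS).
Qed.

Lemma representable_by_columns (K : fieldType) (T : finType) (X : {set T})
    (indep : {set T} -> Prop) (m : nat) (g : T -> 'cV[K]_m) :
  (forall S, indep S <-> S \subset X /\ free [seq g x | x <- enum S]) ->
  representable K X indep.
Proof.
move=> indepP; split.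
  split=> [S /indepP[] //||S S' sS /indepP[SX fS]|].
  - by apply/indepP; rewrite sub0set enum_set0 nil_free.
  - by apply/indepP; rewrite (subset_trans sS) ?(free_map_subset sS fS).
  move=> S S' /indepP[SX fS] /indepP[SX' fS'] ltS.
  (* Augmentation: if every column of [S'] lay in the span of those of [S], comparing dimensions
     would give [#|S'| <= #|S|]. *)
  have [/existsP[x /andP[xS' gx]]|] := boolP [exists x,
      (x \in S') && (g x \notin <<[seq g y | y <- enum S]>>%VS)].
    have xS : x \notin S.
      apply: contraNN gx => xS; apply: memv_span.
      by apply: map_f; rewrite mem_enum.
    exists x; split=> //; apply/indepP; split.
      by rewrite subUset sub1set (subsetP SX' _ xS').
    rewrite (@free_map_perm _ _ _ _ _ (x :: enum S)) ?map_cons ?free_cons ?gx //.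
    apply: uniq_perm; rewrite /= ?enum_uniq ?mem_enum ?xS // => y.
    by rewrite inE !mem_enum !inE.
  rewrite negb_exists => /forallP all_in.
  have : (<<[seq g x | x <- enum S']>> <= <<[seq g x | x <- enum S]>>)%VS.
    apply/span_subvP=> _ /mapP[x xS' ->]; have := all_in x.
    by rewrite mem_enum in xS'; rewrite xS' negbK.
  move/dimvS; rewrite (eqnP fS) (eqnP fS') !size_map -!cardE leqNgt ltS //.
pose U := {x : T | x \in X}.
exists m, #|{: U}|, (\matrix_(i, j) g (val (enum_val j : U)) i ord0)%R, enum_rank.
split=> [|S]; first exact: enum_rank_bij.
have colE x : col (enum_rank x)
    (\matrix_(i, j) g (val (enum_val j : U)) i ord0)%R = g (val x).
  by apply/matrixP=> i j; rewrite !mxE enum_rankK (ord1 j).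
rewrite (eq_map colE) (map_comp g val).
rewrite (@free_map_perm _ _ _ g (map val (enum S)) (enum (val @: S))).
  split=> [/indepP[] //|fS]; apply/indepP; split=> //.
  by apply/subsetP=> _ /imsetP[x _ ->]; apply: valP.
apply: uniq_perm; rewrite ?(map_inj_uniq val_inj) ?enum_uniq // => x.
rewrite mem_enum; apply/mapP/imsetP => -[y yS ->]; exists y => //.
  by rewrite mem_enum in yS.
by rewrite mem_enum.
Qed.

Local Open Scope ring_scope.

Lemma F2_neq0 (k : 'F_2) : k != 0 -> k = 1.
Proof. by case: k => [[|[|]]] // lt2 _; apply: val_inj. Qed.

(** Over F_2 a family of coefficients is the indicator of its support, so linear combinations are
    subset sums. *)
Lemma free_F2P (vT : vectType 'F_2) (T : finType) (g : T -> vT) (S : {set T}) :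
  free [seq g x | x <- enum S] <->
  forall B : {set T}, B \subset S -> \sum_(x in B) g x = 0 -> B = set0.
Proof.
have nthE (i : 'I_#|S|) : [seq g x | x <- enum S]`_i = g (enum_val i).
  by rewrite (nth_map (enum_default i)) -?cardE // -enum_val_nth.
have sumE (k : T -> 'F_2) :
    \sum_(i < #|S|) k (enum_val i) *: [seq g x | x <- enum S]`_i
    = \sum_(x in S) k x *: g x.
  by rewrite [RHS]big_enum_val; apply: eq_bigr => i _; rewrite nthE.
have tupP : size [seq g x | x <- enum S] == #|S| by rewrite size_map -cardE.
split=> [/(@freeP _ _ _ (Tuple tupP)) /= fS B sBS sumB|indepS].
  apply/setP=> x; rewrite inE; apply/negbTE/negP => xB.
  have xS := subsetP sBS x xB.
  have sum0 : \sum_(y in S) (y \in B)%:R *: g y = 0.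
    rewrite -[RHS]sumB big_mkcond [RHS]big_mkcond; apply: eq_bigr => y _.
    have [/(subsetP sBS)->|_] := boolP (y \in B); first by rewrite scale1r.
    by rewrite scale0r if_same.
  rewrite -(sumE (fun y => (y \in B)%:R)) in sum0.
  move/(_ _ sum0 (enum_rank_in xS x)): fS.
  by rewrite enum_rankK_in // xB => /eqP; rewrite oner_eq0.
apply/(@freeP _ _ _ (Tuple tupP)) => /= k sumk i.
apply: contra_not_eq (_ : ~ (enum_val i \in set0)); last by rewrite inE.
move=> ki; pose N := [set j | k j != 0].
rewrite -(indepS (enum_val @: N)); first by rewrite imset_f // inE.
  by apply/subsetP=> _ /imsetP[j _ ->]; apply: enum_valP.
rewrite big_imset /=; last by move=> ? ? _ _; apply: enum_val_inj.
rewrite -[RHS]sumk big_mkcond; apply: eq_bigr => j _; rewrite inE nthE.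
by case: eqP => [->|/eqP/F2_neq0->]; rewrite ?scale0r ?scale1r.
Qed.

(** * The columns of the arcs: linear forests are the independent sets *)

Definition unit_column (I : finType) (r : I) : 'cV['F_2]_#|I| :=
  delta_mx (enum_rank r) ord0.

Lemma unit_columnE (I : finType) (r r' : I) :
  unit_column r (enum_rank r') ord0 = (r == r')%:R.
Proof. by rewrite mxE andbT (inj_eq enum_rank_inj) eq_sym. Qed.

Lemma addcv_F2 m (u : 'cV['F_2]_m) : u + u = 0.
Proof. by rewrite -mulr2n -scaler_nat pchar_Zp // scale0r. Qed.

(* On a directed cycle the columns are those of the vertex-edge incidence
   matrix, whose only dependency is the whole cycle. *)
Definition arc_column (G : digraph) (e : vert G * vert G) :=
  if ~~ loopless e then 0
  else if on_cycle e then unit_column (inl e.1) + unit_column (inl e.2)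
  else unit_column (arc_key e).

Lemma linear_forest_loopless (V : finType) (A : {set V * V}) e :
  linear_forest A -> e \in A -> loopless e.
Proof.
(* A loop is a directed cycle through a single vertex. *)
case=> _ _ acyc eA; apply/negP => /eqP e12; apply: (acyc [:: e.1]) => //.
by rewrite /= andbT /Defs.arc /= {2}e12 -surjective_pairing.
Qed.

(** If [e] in [B] is off the cycles, it alone contributes to the coordinate [arc_key e]: another arc
    off the cycles with this key would share an endpoint with [e] in the same role, which a linear
    forest forbids. *)
Lemma linear_forest_zero_sum_on_cycle (G : digraph)
    (A B : {set vert G * vert G}) :
  MP2 G -> A \subset arcs G -> linear_forest A -> B \subset A ->
  \sum_(e in B) arc_column e = 0 -> {in B, forall e, on_cycle e}.
Proof.
move=> mp2 sAG lfA sBA sumB e eB; apply/negPn/negP => ecyc.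
have [inj1 inj2 _] := lfA.
have BG f : f \in B -> f \in arcs G.
  by move=> fB; rewrite (subsetP sAG) ?(subsetP sBA).
have Bl f : f \in B -> loopless f.
  by move=> fB; apply: linear_forest_loopless lfA _; rewrite ?(subsetP sBA).
have := congr1 (fun M : 'cV_ _ => M (enum_rank (arc_key e)) ord0) sumB.
rewrite summxE mxE (bigD1 e) //= {1}/arc_column (Bl _ eB) (negPf ecyc) /=.
rewrite unit_columnE eqxx big1 ?addr0 => [/eqP|f /andP[fB nfe]].
  by rewrite oner_eq0.
rewrite /arc_column (Bl _ fB) /=; case: ifPn => fcyc.
  (* Cycle columns and keys both use [inl] coordinates. They cannot meet here, since by MP2 an arc
     that touches a cycle lies on it. *)
  have key_neq v : (v == f.1) || (v == f.2) -> inl v != arc_key e.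
    move=> vf; apply: contraNneq ecyc; rewrite /arc_key; case: ifP => // _ [ve].
    apply: (on_cycle_incident mp2 (BG _ fB) (BG _ eB)) => //; first exact: Bl.
    by rewrite -ve vf.
  by rewrite mxE !unit_columnE !(negPf (key_neq _ _)) ?eqxx ?orbT ?addr0.
rewrite unit_columnE; case: eqP => // /arc_key_eq fe.
case/eqP: nfe; case: fe => [/inj1 | /inj2]; apply; exact: subsetP sBA _ _.
Qed.

(** Only arcs on cycles remain. A zero sum makes every vertex meet evenly many arc ends, so each arc
    of [B] is followed by another; a nonempty [B] would then contain a whole directed cycle, against
    acyclicity of [A]. *)
Lemma linear_forest_independent (G : digraph) (A B : {set vert G * vert G}) :
  MP2 G -> A \subset arcs G -> linear_forest A -> B \subset A ->
  \sum_(e in B) arc_column e = 0 -> B = set0.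
Proof.
move=> mp2 sAG lfA sBA sumB; have [inj1 inj2 acyc] := lfA.
have Bcyc := linear_forest_zero_sum_on_cycle mp2 sAG lfA sBA sumB.
have BG f : f \in B -> f \in arcs G.
  by move=> fB; rewrite (subsetP sAG) ?(subsetP sBA).
have Bl f : f \in B -> loopless f.
  by move=> fB; apply: linear_forest_loopless lfA _; rewrite ?(subsetP sBA).
have succB e : e \in B -> exists2 f, f \in B & f.1 = e.2.
  move=> eB.
  pose i := enum_rank (inl e.2 : vert G + vert G).
  have := congr1 (fun M : 'cV_ _ => M i ord0) sumB; rewrite summxE mxE.
  have -> : \sum_(f in B) arc_column f i ord0 =
      \sum_(f in B) (f.1 == e.2)%:R + \sum_(f in B) (f.2 == e.2)%:R :> 'F_2.
    rewrite -big_split; apply: eq_bigr => f fB.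
    by rewrite /arc_column Bl // Bcyc //= mxE !unit_columnE.
  (* In the coordinate of [e.2], the only arc of [B] entering [e.2] is [e], which contributes 1;
     some arc of [B] must leave [e.2] to cancel it. *)
  rewrite [X in _ + X](bigD1 e) //= eqxx [X in _ + (_ + X)]big1; last first.
    move=> f /andP[fB /eqP nfe]; case: eqP => // /inj2 fe.
    by case: nfe; apply: fe; apply: (subsetP sBA).
  case: (boolP [exists f in B, f.1 == e.2]) => [/exists_inP[f fB /eqP]|].
    by move=> *; exists f.
  rewrite negb_exists_in => /forall_inP noB.
  rewrite big1 ?add0r ?addr0 => [/eqP|f fB]; first by rewrite oner_eq0.
  by rewrite (negPf (noB f fB)).
apply/eqP; apply: contraT => /set0Pn[e eB].
have [c [c2 uc cc ec]] := on_cycleP (BG e eB) (Bl e eB) (Bcyc e eB).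
have nextB f : f \in B -> (f.1 \in c) || (f.2 \in c) ->
    f.1 \in c /\ f.2 = next c f.1.
  by move=> fB; apply: MP2_cycle_arc => //; apply: BG.
(* By MP2 the successor arcs supplied by [succB] stay on [c], so they run through its vertices in
   order. *)
have iterB n : exists2 f, f \in B & f.1 = iter n (next c) e.1.
  elim: n => [|n [f fB fn]]; first by exists e.
  have f1c : f.1 \in c by rewrite fn; elim: n {fn} => //= n; rewrite mem_next.
  have [g gB gf] := succB f fB; exists g; rewrite // gf iterS -fn.
  by have [] := nextB f fB; rewrite ?f1c.
case: (acyc c) => //; first by rewrite -size_eq0 -lt0n ltnW.
have arcB x : x \in c -> (x, next c x) \in A.
  move=> xc; have ex : fconnect (next c) e.1 x.
    by rewrite (fconnect_cycle (cycle_next uc) ec).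
  have [f fB] := iterB (findex (next c) e.1 x); rewrite iter_findex // => f1.
  have [|_ f2] := nextB f fB; first by rewrite f1 xc.
  by rewrite -f1 -f2 -surjective_pairing (subsetP sBA).
apply: (@sub_in_cycle _ (mem c) (frel (next c))) (cycle_next uc).
  by move=> x y xc _ /eqP <-; apply: arcB.
exact/allP.
Qed.

(** Each obstruction to being a linear forest yields a nonempty zero sum: a loop has column zero,
    two conflicting arcs have equal columns, and the columns around a directed cycle cancel. *)
Lemma independent_linear_forest (G : digraph) (A : {set vert G * vert G}) :
  MP_digraph G -> A \subset arcs G ->
  (forall B : {set vert G * vert G}, B \subset A ->
     \sum_(e in B) arc_column e = 0 -> B = set0) ->
  linear_forest A.
Proof.
move=> [mp1 mp2] sAG indA.
have AG f : f \in A -> f \in arcs G by apply: subsetP.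
have Al e : e \in A -> loopless e.
  move=> eA; have [//|le] := boolP (loopless e).
  suff /setP/(_ e) : [set e] = set0 by rewrite !inE eqxx.
  by apply: indA; rewrite ?sub1set // big_set1 /arc_column le.
have col_inj : {in A &, injective (@arc_column G)}.
  move=> e f eA fA ef; apply/eqP/negPn/negP => nef.
  suff /setP/(_ e) : [set e; f] = set0 by rewrite !inE eqxx.
  apply: indA; first by rewrite subUset !sub1set eA.
  by rewrite big_setU1 /= ?in_set1 // big_set1 ef addcv_F2.
(* Both arcs lie on the same cycle, where [next] is injective, so the source and the target
   determine each other. *)
have cycE e f : e \in A -> f \in A -> e.1 = f.1 \/ e.2 = f.2 ->
    on_cycle e -> e = f.
  move=> eA fA ef ecyc.
  have [c [c2 uc cc ec]] := on_cycleP (AG e eA) (Al e eA) ecyc.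
  have [_ e2] :=
    MP2_cycle_arc mp2 c2 uc cc (AG e eA) (introT orP (or_introl ec)).
  have [f1c f2] : f.1 \in c /\ f.2 = next c f.1.
    apply: (MP2_cycle_arc mp2) => //; first exact: AG.
    by case: ef => <-; rewrite ?e2 ?mem_next ec ?orbT.
  apply: injective_projections; case: ef => //; rewrite e2 f2.
    exact: (can_inj (prev_next uc)).
  by move->.
have conflict e f : e \in A -> f \in A -> e.1 = f.1 \/ e.2 = f.2 -> e = f.
  move=> eA fA ef; have [ecyc|ecyc] := boolP (on_cycle e); first exact: cycE.
  have [fcyc|fcyc] := boolP (on_cycle f).
    by apply/esym/cycE => //; case: ef; [left | right].
  apply: col_inj; rewrite // /arc_column !Al // (negPf ecyc) (negPf fcyc) /=.
  congr unit_column; case: ef => ef.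
    by apply: arc_key_source; rewrite ?AG ?Al.
  by apply: arc_key_target; rewrite ?AG ?Al.
split=> [e f eA fA ef|e f eA fA ef|c c0 uc ccA].
- by apply: conflict => //; left.
- by apply: conflict => //; right.
pose B := [set (x, next c x) | x in c].
have sBA : B \subset A.
  by apply/subsetP=> _ /imsetP[x xc ->]; apply: (next_cycle ccA xc).
have cc : cycle (@Defs.arc G) c.
  by apply: sub_cycle ccA => x y; apply: (subsetP sAG).
have [x xc] : exists x, x \in c.
  by case: (c) c0 => // x s _; exists x; rewrite mem_head.
suff /setP/(_ (x, next c x)) : B = set0.
  by rewrite inE (imset_f (fun y => (y, next c y)) xc).
apply: indA => //; rewrite big_imset /=; last by move=> y z _ _ [].
(* Every vertex of the cycle occurs once as a source and once as a target; reindexing by [next]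
   makes the two sums equal, and they cancel in characteristic 2. *)
transitivity (\sum_(y in c) unit_column (inl y : vert G + vert G) +
              \sum_(y in c) unit_column (inl (next c y) : vert G + vert G)).
  rewrite -big_split; apply: eq_bigr => y yc.
  have yA : (y, next c y) \in A := next_cycle ccA yc.
  by rewrite /arc_column Al // cycle_on_cycle.
rewrite [X in X + _](reindex_inj (can_inj (prev_next uc))).
by under eq_bigl do rewrite mem_next; rewrite addcv_F2.
Qed.

Unset Implicit Arguments.
Local Close Scope ring_scope.

Theorem theorem4p18 (G : digraph) (HG : MP_digraph G) :
  binary (arcs G) (@multipath G).
Proof.
(* Linear forests link the two sides: they are the multipaths, and also the sets of arcs in which no
   nonempty subset has column sum zero. *)
apply: (@representable_by_columns _ _ _ _ _ (@arc_column G)) => A; split.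
  move=> mA; have sAG := proj1 mA; split=> //; apply/free_F2P => B.
  apply: linear_forest_independent sAG _; first by case: HG.
  exact: multipath_linear_forest.
case=> sAG /free_F2P indA; apply: linear_forest_multipath => //.
exact: independent_linear_forest.
Qed.
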